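(* Let $(G,w)$ be a weighted graph, let $\varphi\colon[0,\infty)\to[0,\infty)$ be a homeomorphism, and let $\Phi(x,y)=\varphi^{-1}(\varphi(x)+\varphi(y))$ for $x,y\in[0,\infty)$. Then the weight $w$ is $\Phi$-pseudosemimetrizable if and only if for every cycle $C\subseteq G$ and every edge $e\in E(C)$ the inequality $$w(e)\leqslant\varphi^{-1}\left(\sum_{\tilde e\in E(C)\setminus\{e\}}\varphi(w(\tilde e))\right)$$ holds.
   Context: $\mathbb{R}^+=[0,\infty)$. A graph $G=(V(G),E(G))$ is simple and may be finite or infinite, with $V(G)\neq\varnothing$; edges are two-element subsets of $V(G)$; cycles are finite and simple. A weighted graph $(G,w)$ is a graph $G$ together with a function $w\colon E(G)\to\mathbb{R}^+$. A pseudosemimetric on a nonempty set $X$ is a function $d\colon X\times X\to\mathbb{R}^+$ with $d(x,x)=0$ and $d(x,y)=d(y,x)$ for all $x,y\in X$; it is a $\Phi$-pseudosemimetric if $d(x,y)\leqslant\Phi(d(x,z),d(y,z))$ for all $x,y,z\in X$. The weight $w$ is $\Phi$-pseudosemimetrizable if there is a $\Phi$-pseudosemimetric $d\colon V(G)\times V(G)\to\mathbb{R}^+$ with $w(\{u,v\})=d(u,v)$ for all $\{u,v\}\in E(G)$. *)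

(* Defs.v *)
From HB Require Import structures.
From mathcomp Require Import all_boot all_order all_algebra.
From mathcomp Require Import all_classical all_reals all_analysis.

Set Implicit Arguments.
Unset Strict Implicit.
Unset Printing Implicit Defensive.

Import Order.TTheory GRing.Theory Num.Theory.
Import numFieldNormedType.Exports.

Local Open Scope classical_set_scope.
Local Open Scope ring_scope.

(* Simple, possibly infinite graphs. The vertex set is an arbitrary nonempty
   subset of an ambient type [T], so that subgraphs of [G] live in the same
   type as [G]. *)
Record graph (T : Type) := Graph {
  verts : set T;
  edges : set (set T);
  verts_nonempty : verts !=set0;
  edgesP : forall e, edges e ->
    exists u v, [/\ verts u, verts v, u <> v & e = [set u; v]] }.

Definition subgraph (T : Type) (H G : graph T) : Prop :=
  verts H `<=` verts G /\ edges H `<=` edges G.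

(* [ordS i] is the cyclic successor of [i] in ['I_n]. *)
Definition is_cycle (T : Type) (C : graph T) : Prop :=
  exists (n : nat) (x : 'I_n -> T),
    [/\ (3 <= n)%N, injective x, verts C = range x &
        edges C = range (fun i => [set x i; x (ordS i)])].

Definition Rplus (R : realType) : set R := `[0, +oo[%classic.
Arguments Rplus : clear implicits.

(* Functions on [0, +oo[ are represented by total functions [R -> R]; only
   their values on [Rplus R] matter. *)
Definition Rplus_inv (R : realType) (phi : R -> R) : R -> R :=
  'pinv_(fun=> 0) (Rplus R) phi.

Definition Rplus_homeo (R : realType) (phi : R -> R) : Prop :=
  [/\ set_bij (Rplus R) (Rplus R) phi,
      {within Rplus R, continuous phi} &
      {within Rplus R, continuous (Rplus_inv phi)}].

(* A weight is only meaningful on the edges of [G]. *)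
Definition is_weight (R : realType) (T : Type) (G : graph T)
    (w : set T -> R) : Prop :=
  set_fun (edges G) (Rplus R) w.

Definition pseudosemimetric (R : realType) (T : Type) (X : set T)
    (d : T -> T -> R) : Prop :=
  [/\ forall x y, X x -> X y -> Rplus R (d x y),
      forall x, X x -> d x x = 0 &
      forall x y, X x -> X y -> d x y = d y x].

Definition Phi_pseudosemimetric (R : realType) (Phi : R -> R -> R)
    (T : Type) (X : set T) (d : T -> T -> R) : Prop :=
  pseudosemimetric X d /\
  forall x y z, X x -> X y -> X z -> d x y <= Phi (d x z) (d y z).

Definition Phi_pseudosemimetrizable (R : realType) (Phi : R -> R -> R)
    (T : Type) (G : graph T) (w : set T -> R) : Prop :=
  exists d : T -> T -> R, Phi_pseudosemimetric Phi (verts G) d /\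
    forall u v, edges G [set u; v] -> w [set u; v] = d u v.

(* Main.v *)
Require Import Defs.
From mathcomp Require Import all_boot all_order all_algebra.
From mathcomp Require Import all_classical all_reals all_analysis.
From mathcomp Require Import lra zify.

Set Implicit Arguments.
Unset Strict Implicit.
Unset Printing Implicit Defensive.

Import Order.TTheory GRing.Theory Num.Theory.

Local Open Scope classical_set_scope.
Local Open Scope ring_scope.

(** A self-homeomorphism phi of the half-line is strictly increasing and fixes
    0.  Hence, with D = phi o d and c = phi o w, the Phi-triangle inequality
    for d is the ordinary one for D, and the inequality on a cycle says that
    the cost c of an edge is at most the total cost of the other edges.  The
    claim is thus that a nonnegative edge cost c extends to a pseudometric on
    the vertices iff it satisfies these polygon inequalities
    ([cycle_ineq_indexed] restates them over injective cyclic sequences).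

    Necessity ([metric_cycle_ineq]): for a cycle x_0, ..., x_(n-1) and a fixed
    k, the function i |-> D(x_i, x_k) changes by at most D(x_i, x_(i+1)) from
    i to i+1, and its total change around the cycle is 0; so its jump across
    the k-th edge, which is D(x_(k+1), x_k), is bounded by the sum over the
    other edges.

    Sufficiency: let the distance of two vertices in one connected component
    be the infimum of the costs of the walks joining them.  Concatenation of
    walks gives the triangle inequality.  For an edge uv the infimum is
    c(u, v): a walk from u to v can be cut down to a simple path
    ([simple_walk]), which either is the edge itself or closes up with it to a
    cycle, so it costs at least c(u, v) ([le_walk_costs]).  Vertices in
    different components need a finite distance too: a base point is chosen in
    every component, all base points are glued together, and the distance is
    the sum of the distances to the base points ([glued_dist]). *)

(** * Self-homeomorphisms of the half-line *)

Section HalfLineHomeomorphism.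
Variables (R : realType) (phi : R -> R).
Hypothesis phi_homeo : Rplus_homeo phi.

Lemma RplusP (x : R) : Rplus R x <-> 0 <= x.
Proof. by rewrite /Rplus /= in_itv /= andbT. Qed.

Lemma mem_Rplus (x : R) : (x \in Rplus R) = (0 <= x).
Proof. by apply/idP/idP => [/set_mem/RplusP|/RplusP/mem_set]. Qed.

Lemma homeo_ge0 (x : R) : 0 <= x -> 0 <= phi x.
Proof. by case: phi_homeo => -[+ _ _] _ _ => h /RplusP/h/RplusP. Qed.

Lemma homeo_inv_ge0 (y : R) : 0 <= y -> 0 <= Rplus_inv phi y.
Proof.
case: phi_homeo => phi_bij _ _ /RplusP y0.
by have [+ _ _] := bijpinv_bij (fun=> 0) phi_bij; move=> /(_ _ y0)/RplusP.
Qed.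

Lemma homeo_invK (y : R) : 0 <= y -> phi (Rplus_inv phi y) = y.
Proof.
case: phi_homeo => -[_ _ phi_surj] _ _ y0.
by apply: (surjpK (fun=> 0) phi_surj); rewrite mem_Rplus.
Qed.

Lemma homeo_inj : {in Rplus R &, injective phi}.
Proof. by case: phi_homeo => -[]. Qed.

Lemma homeoK (x : R) : 0 <= x -> Rplus_inv phi (phi x) = x.
Proof. by move=> x0; apply: (pinvKV _ homeo_inj); rewrite mem_Rplus. Qed.

(** A continuous injection of an interval is strictly monotone, and a
    decreasing map cannot be onto the half-line: the value [phi 0 + 1] would
    exceed the maximum [phi 0]. *)
Lemma homeo_lt (x y : R) : 0 <= x -> x < y -> phi x < phi y.
Proof.
move=> x0 xy.
case: phi_homeo => _ phi_cont _.
have phi_inj : {in `[0, +oo[ &, injective phi}.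
  by move=> a b; rewrite !in_itv /= !andbT => a0 b0; apply: homeo_inj;
     rewrite mem_Rplus.
have mem (a : R) : 0 <= a -> a \in `[0, +oo[ by rewrite in_itv /= andbT.
have [incr|decr] := itv_continuous_inj_mono phi_cont phi_inj.
  by apply: incr; rewrite ?mem// (le_trans x0 (ltW xy)).
have p0 : 0 <= phi 0 + 1 by rewrite addr_ge0 ?homeo_ge0.
set z := Rplus_inv phi (phi 0 + 1).
have z0 : 0 <= z by apply: homeo_inv_ge0.
have phiz : phi z = phi 0 + 1 by apply: homeo_invK.
move: z0; rewrite le_eqVlt => /orP[/eqP zE|z0].
  by move: phiz; rewrite -zE; lra.
have := decr z 0 (mem _ (ltW z0)) (mem _ (lexx _)) z0.
by rewrite phiz ltNge lerDl ler01.
Qed.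

Lemma homeo_le (x y : R) : 0 <= x -> 0 <= y -> (phi x <= phi y) = (x <= y).
Proof.
move=> x0 y0; have [xy|yx] := leP x y.
  move: xy; rewrite le_eqVlt => /orP[/eqP->|xy]; first by rewrite lexx.
  by rewrite ltW// homeo_lt.
by apply/negbTE; rewrite -ltNge homeo_lt.
Qed.

Lemma le_homeo_inv (x y : R) :
  0 <= x -> 0 <= y -> (x <= Rplus_inv phi y) = (phi x <= y).
Proof. by move=> x0 y0; rewrite -homeo_le ?homeo_inv_ge0// homeo_invK. Qed.

Lemma homeo0 : phi 0 = 0.
Proof.
apply/eqP; rewrite eq_le homeo_ge0// andbT.
by rewrite -[leRHS]homeo_invK// homeo_le ?homeo_inv_ge0.
Qed.

End HalfLineHomeomorphism.

(** * Edges of a cycle *)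

Lemma set2_eqP (T : Type) (a b c d : T) :
  [set a; b] = [set c; d] -> (a = c /\ b = d) \/ (a = d /\ b = c).
Proof.
move=> E.
have : [set c; d] a by rewrite -E; left.
have : [set c; d] b by rewrite -E; right.
have : [set a; b] c by rewrite E; left.
have : [set a; b] d by rewrite E; right.
by move=> /= [] ? [] ? [] ? [] ?; subst; auto.
Qed.

Lemma edge_verts (T : Type) (G : graph T) (u v : T) :
  edges G [set u; v] -> verts G u /\ verts G v.
Proof.
move=> /edgesP[a [b [Ga Gb _ E]]].
by case: (set2_eqP E) => -[-> ->].
Qed.

Section Cycles.
Variables (T : Type) (n : nat) (x : 'I_n -> T).
Hypotheses (n_ge3 : (3 <= n)%N) (x_inj : injective x).

Lemma ordS_neq (i : 'I_n) : ordS i <> i.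
Proof.
move=> /(congr1 val) /=; case: i => i /= ltin.
have [ltSn|leSn] := ltnP i.+1 n; first by rewrite modn_small//; lia.
have -> : i.+1 = n by lia.
by rewrite modnn; lia.
Qed.

(** This is where cycles need length at least 3: on two vertices both cyclic
    steps would give the same edge. *)
Lemma ordS2_neq (i : 'I_n) : ordS (ordS i) <> i.
Proof.
move=> /(congr1 val) /=; case: i => i /= ltin.
have [ltSn|leSn] := ltnP i.+1 n; last first.
  have -> : i.+1 = n by lia.
  by rewrite modnn modn_small; lia.
rewrite (modn_small ltSn).
have [ltSSn|leSSn] := ltnP i.+2 n; first by rewrite modn_small//; lia.
have -> : i.+2 = n by lia.
by rewrite modnn; lia.
Qed.

Lemma cycle_edge_inj : injective (fun i => [set x i; x (ordS i)]).
Proof.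
move=> i j ij; case: (set2_eqP ij) => -[xij xji]; first exact: x_inj.
have iE := x_inj xij; have jE := x_inj xji.
by case: (@ordS2_neq j); rewrite -iE.
Qed.

Lemma sum_cycle_edges (R : realType) (F : set T -> R) (k : 'I_n) :
  \sum_(f \in range (fun i => [set x i; x (ordS i)])
                `\ [set x k; x (ordS k)]) F f =
  \sum_(i < n | i != k) F [set x i; x (ordS i)].
Proof.
have -> : range (fun i => [set x i; x (ordS i)]) `\ [set x k; x (ordS k)] =
    (fun i => [set x i; x (ordS i)]) @` [set` predC1 k].
  apply/seteqP; split => [f [[i _ <-] /= fk]|f [i /= /eqP ik <-]].
    by exists i => //=; apply/eqP => ik; apply: fk; rewrite ik.
  by split; [exists i|move=> /cycle_edge_inj].
rewrite fsbig_image; last by move=> i j _ _ /cycle_edge_inj.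
symmetry; apply: bigfs; first exact: index_enum_uniq.
by move=> i _; rewrite mem_index_enum.
Qed.

Lemma cycle_edge_ends (i : 'I_n) (e : set T) :
  e = [set x i; x (ordS i)] ->
  exists u v, [/\ range x u, range x v, u <> v & e = [set u; v]].
Proof.
move=> ->; exists (x i), (x (ordS i)); split => //.
by move=> /x_inj/esym/ordS_neq.
Qed.

End Cycles.

(** Trades subgraphs and sums over sets of edges for cyclic sequences of
    vertices and sums over indices, and applies phi to both sides. *)
Lemma cycle_ineq_indexed (R : realType) (T : Type) (G : graph T)
    (w : set T -> R) (phi : R -> R) :
  is_weight G w -> Rplus_homeo phi ->
  (forall C : graph T, is_cycle C -> subgraph C G ->
   forall e : set T, edges C e ->
     w e <= Rplus_inv phi (\sum_(f \in edges C `\ e) phi (w f))) <->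
  (forall (n : nat) (x : 'I_n -> T), (3 <= n)%N -> injective x ->
   (forall i, edges G [set x i; x (ordS i)]) -> forall k,
     phi (w [set x k; x (ordS k)]) <=
     \sum_(i < n | i != k) phi (w [set x i; x (ordS i)])).
Proof.
move=> w_ge0 phi_homeo.
have w0 e : edges G e -> 0 <= w e by move=> /w_ge0/RplusP.
split => [ineq n x n3 x_inj xG k|ineq C].
  have x0 : range x !=set0 by exists (x k), k.
  have xE e : range (fun i => [set x i; x (ordS i)]) e ->
      exists u v, [/\ range x u, range x v, u <> v & e = [set u; v]].
    by move=> [i _ /esym]; apply: cycle_edge_ends.
  have CG : subgraph (Graph x0 xE) G.
    split => [_ [i _ <-]|_ [i _ <-]] //=.
    by case: (edge_verts (xG i)).
  have := ineq _ (ex_intro _ n (ex_intro _ x _)) CG [set x k; x (ordS k)].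
  rewrite /= sum_cycle_edges// le_homeo_inv//; first last.
  - by apply: sumr_ge0 => i _; rewrite homeo_ge0 ?w0.
  - exact: w0.
  by apply; [split|exists k].
move=> [n [x [n3 x_inj CV CE]]] [_ CG] e; rewrite CE => -[k _ <-].
have xG i : edges G [set x i; x (ordS i)] by apply: CG; rewrite CE; exists i.
rewrite sum_cycle_edges// le_homeo_inv//; first exact: ineq.
  exact: w0.
by apply: sumr_ge0 => i _; rewrite homeo_ge0 ?w0.
Qed.

(** * Pseudometrics satisfy the polygon inequality *)

(** The distance to [x k] telescopes to 0 around the cycle, so its increase
    across the [k]-th edge is the total decrease across the others.  Fixing
    the reference point [x k] avoids rotating the cycle. *)
Lemma metric_cycle_ineq (R : realType) (T : Type) (X : set T) (D : T -> T -> R)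
    (n : nat) (x : 'I_n -> T) (k : 'I_n) :
  (forall y, X y -> D y y = 0) ->
  (forall y z, X y -> X z -> D y z = D z y) ->
  (forall y z t, X y -> X z -> X t -> D y z <= D y t + D t z) ->
  (forall i, X (x i)) ->
  D (x k) (x (ordS k)) <= \sum_(i < n | i != k) D (x i) (x (ordS i)).
Proof.
move=> D0 DC Dtri xX; pose f i := D (x i) (x k).
have tele : \sum_(i < n) (f i - f (ordS i)) = 0.
  rewrite sumrB [X in X - _](reindex (@ordS n)) ?subrr//.
  exact/onW_bij/ordS_bij.
rewrite DC// -/(f (ordS k)).
move: tele; rewrite (bigD1 k)//= {1}/f D0// sub0r => /eqP.
rewrite addrC subr_eq0 => /eqP <-.
by apply: ler_sum => i _; rewrite lerBlDr; apply: Dtri.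
Qed.

(** * Walks and their costs *)

Section Walks.
Variables (R : realType) (T : choiceType) (e : rel T) (c : T -> T -> R).

(** The walk visits [x] and then the vertices of [s] in order. *)
Definition walk_cost (x : T) (s : seq T) : R := \sum_(a <- pairmap c x s) a.

Definition walk_costs (x y : T) : set R :=
  [set walk_cost x s | s in [set s | path e x s /\ last x s = y]].

Hypotheses (eC : symmetric e) (cC : forall x y, c x y = c y x).
Hypothesis c_ge0 : forall x y, e x y -> 0 <= c x y.

Lemma walk_cost_cons x y s : walk_cost x (y :: s) = c x y + walk_cost y s.
Proof. by rewrite /walk_cost /= big_cons. Qed.

Lemma walk_cost_cat x s t :
  walk_cost x (s ++ t) = walk_cost x s + walk_cost (last x s) t.
Proof. by rewrite /walk_cost pairmap_cat big_cat. Qed.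

Lemma walk_cost_ge0 x s : path e x s -> 0 <= walk_cost x s.
Proof.
elim: s x => [|y s IHs] x; first by rewrite /walk_cost big_nil.
by rewrite walk_cost_cons => /andP[exy /IHs]; apply: addr_ge0; exact: c_ge0.
Qed.

Lemma walk_costs0 x : walk_costs x x 0.
Proof. by exists [::] => //; rewrite /walk_cost big_nil. Qed.

Lemma walk_costs1 x y : e x y -> walk_costs x y (c x y).
Proof.
by move=> exy; exists [:: y]; rewrite /= ?exy// /walk_cost /= big_seq1.
Qed.

Lemma walk_costs_ge0 x y a : walk_costs x y a -> 0 <= a.
Proof. by move=> [s [xs _] <-]; apply: walk_cost_ge0. Qed.

Lemma walk_costsD x y z a b :
  walk_costs x y a -> walk_costs y z b -> walk_costs x z (a + b).
Proof.
move=> [s [xs sy] <-] [t [yt tz] <-]; exists (s ++ t).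
  by rewrite /= cat_path last_cat sy xs yt.
by rewrite walk_cost_cat sy.
Qed.

Lemma walk_costsC x y a : walk_costs x y a -> walk_costs y x a.
Proof.
move=> [s [xs sy] <-]; elim: s x xs sy => [|z s IHs] x /=.
  by move=> _ ->; rewrite /walk_cost big_nil; apply: walk_costs0.
move=> /andP[exz zs] sy; rewrite walk_cost_cons addrC.
by apply: walk_costsD (IHs z zs sy) _; rewrite cC; apply: walk_costs1; rewrite eC.
Qed.

(** Cutting closed detours out of a walk does not raise its cost. *)
Lemma simple_walk x s : path e x s ->
  exists t, [/\ path e x t, last x t = last x s, uniq (x :: t) &
                walk_cost x t <= walk_cost x s].
Proof.
elim: s x => [|y s IHs] x; first by exists [::].
move=> /= /andP[exy /IHs[t [yt tE t_uniq le_ts]]].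
(* If [x] recurs on the simple walk from [y], only the part after that
   occurrence is kept. *)
have [xt|xt] := boolP (x \in y :: t); last first.
  exists (y :: t); split=> //=; first by rewrite exy.
    by rewrite xt.
  by rewrite !walk_cost_cons lerD2l.
case/splitPl: xt yt tE t_uniq le_ts => t1 t2 t1E.
rewrite cat_path last_cat walk_cost_cat t1E => /andP[yt1 xt2] tE t_uniq le_ts.
exists t2; split => //.
  move: t_uniq; rewrite -cat_cons lastI t1E cat_rcons cat_uniq.
  by case/and3P.
rewrite walk_cost_cons; apply: le_trans (le_trans le_ts _); last first.
  by rewrite lerDr c_ge0.
by rewrite lerDr walk_cost_ge0.
Qed.

Hypothesis e_irr : irreflexive e.
Hypothesis cycle_ineq : forall (n : nat) (x : 'I_n -> T),
  (3 <= n)%N -> injective x -> (forall i, e (x i) (x (ordS i))) -> forall k,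
  c (x k) (x (ordS k)) <= \sum_(i < n | i != k) c (x i) (x (ordS i)).

(** No detour is cheaper than an edge: a simple path with at least two steps,
    closed up by the edge, is a cycle. *)
Lemma le_walk_costs u v a : e u v -> walk_costs u v a -> c u v <= a.
Proof.
move=> euv [s0 [/simple_walk[s [us sE s_uniq les]] s0v] <-].
rewrite s0v in sE; apply: le_trans les; clear s0 s0v.
case: (ltnP 1 (size s)) => [s2|]; last first.
  case: s us sE s_uniq => [|y [|]]//= _ sE _ _.
    by move: euv; rewrite -sE e_irr.
  by rewrite /walk_cost /= big_seq1 -sE.
(* The closing edge of the cycle [x] is {v, u}, with index [ord_max]. *)
pose x (i : 'I_(size s).+1) := nth u (u :: s) i.
have ordSE (i : 'I_(size s).+1) : (i < size s)%N -> x (ordS i) = nth u s i.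
  by move=> ltis; rewrite /x /= modn_small.
have xmax : x ord_max = v by rewrite /x /= -sE -nth_last /=; case: (s) s2.
have xSmax : x (ordS ord_max) = u by rewrite /x /= modnn.
have x_inj : injective x.
  by move=> i j /eqP; rewrite nth_uniq//= ?ltn_ord// => /eqP/val_inj.
have xe i : e (x i) (x (ordS i)).
  have [ltis|leis] := ltnP i (size s).
    by rewrite ordSE//; apply: (pathP u us).
  have -> : i = ord_max by apply: val_inj => /=; have := ltn_ord i; lia.
  by rewrite xmax xSmax eC.
have := @cycle_ineq _ x s2 x_inj xe ord_max.
rewrite xmax xSmax cC => /le_trans; apply.
(* Adding the closing edge to both sides turns the sum over all other indices
   into a sum over the whole range, whose last term splits off. *)
rewrite -(lerD2l (c (x ord_max) (x (ordS ord_max)))).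
have /= <- := bigD1 (op := +%R) ord_max (P := xpredT)
  (F := fun i => c (x i) (x (ordS i))) isT.
rewrite big_ord_recr /= addrC lerD2l.
rewrite /walk_cost (big_nth 0) big_mkord size_pairmap.
by apply: ler_sum => i _; rewrite (nth_pairmap u)// ordSE /=.
Qed.

(** * The walk distance inside a component *)

Definition walk_dist (x y : T) : R := inf (walk_costs x y).

Definition joined (x y : T) : Prop := walk_costs x y !=set0.

Lemma joined_refl x : joined x x.
Proof. by exists 0; apply: walk_costs0. Qed.

Lemma joined_sym x y : joined x y -> joined y x.
Proof. by move=> [a /walk_costsC]; exists a. Qed.

Lemma joined_trans y x z : joined x y -> joined y z -> joined x z.
Proof. by move=> [a xy] [b yz]; exists (a + b); apply: walk_costsD yz. Qed.

Lemma walk_dist_le x y a : walk_costs x y a -> walk_dist x y <= a.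
Proof. by apply: ge_inf; exists 0 => b; apply: walk_costs_ge0. Qed.

Lemma walk_dist_ge0 x y : 0 <= walk_dist x y.
Proof.
have [xy|/set0P/negP/negPn/eqP xy] := pselect (joined x y).
  by apply: lb_le_inf => // a; apply: walk_costs_ge0.
by rewrite /walk_dist xy inf0.
Qed.

Lemma walk_dist0 x : walk_dist x x = 0.
Proof.
by apply/eqP; rewrite eq_le walk_dist_ge0 andbT walk_dist_le//; apply: walk_costs0.
Qed.

Lemma walk_distC x y : walk_dist x y = walk_dist y x.
Proof.
by congr inf; apply/seteqP; split => a; apply: walk_costsC.
Qed.

Lemma walk_dist_triangle x y z : joined x z -> joined z y ->
  walk_dist x y <= walk_dist x z + walk_dist z y.
Proof.
move=> xz zy; rewrite -lerBlDr; apply: lb_le_inf => // a xza.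
rewrite lerBlDr addrC -lerBlDr; apply: lb_le_inf => // b zyb.
by rewrite lerBlDr addrC walk_dist_le//; apply: walk_costsD zyb.
Qed.

Lemma walk_dist_edge u v : e u v -> walk_dist u v = c u v.
Proof.
move=> euv; apply/eqP; rewrite eq_le walk_dist_le/=; last exact: walk_costs1.
apply: lb_le_inf => [|a]; first by exists (c u v); apply: walk_costs1.
exact: le_walk_costs.
Qed.

(** * Gluing the components at base points *)

Variable x0 : T.

(** Chosen from the component as a set, hence constant on it; the common
    default [x0] is never taken, since [x] itself lies in its component. *)
Definition base_point (x : T) : T := xget x0 (joined x).

Definition height (x : T) : R := walk_dist x (base_point x).

Lemma base_point_joined x : joined x (base_point x).
Proof. by apply: xgetPex; exists x; apply: joined_refl. Qed.

Lemma base_point_eq x y : joined x y -> base_point x = base_point y.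
Proof.
move=> xy; congr xget; apply/seteqP; split => z; last exact: joined_trans.
exact/joined_trans/joined_sym.
Qed.

Lemma height_ge0 x : 0 <= height x.
Proof. exact: walk_dist_ge0. Qed.

Lemma height_le x y : joined x y -> height x <= walk_dist x y + height y.
Proof.
move=> xy; rewrite /height (base_point_eq xy).
by apply: walk_dist_triangle => //; apply: base_point_joined.
Qed.

Definition glued_dist (x y : T) : R :=
  if `[< joined x y >] then walk_dist x y else height x + height y.

Lemma glued_dist_ge0 x y : 0 <= glued_dist x y.
Proof.
rewrite /glued_dist; case: ifP => _; first exact: walk_dist_ge0.
by rewrite addr_ge0 ?height_ge0.
Qed.

Lemma glued_dist0 x : glued_dist x x = 0.
Proof.
by rewrite /glued_dist asboolT ?walk_dist0//; apply: joined_refl.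
Qed.

Lemma glued_distC x y : glued_dist x y = glued_dist y x.
Proof.
rewrite /glued_dist walk_distC addrC; congr (if _ then _ else _).
by apply/asboolP/asboolP; apply: joined_sym.
Qed.

Lemma glued_dist_edge u v : e u v -> glued_dist u v = c u v.
Proof.
move=> euv; rewrite /glued_dist asboolT ?walk_dist_edge//.
by exists (c u v); apply: walk_costs1.
Qed.

(** Inside a component [height] is 1-Lipschitz; and if [z] lies outside the
    component of [x] and [y], the walk from [x] to [y] through their common
    base point is short enough. *)
Lemma glued_dist_triangle x y z :
  glued_dist x y <= glued_dist x z + glued_dist z y.
Proof.
rewrite /glued_dist.
have hx := height_ge0 x; have hy := height_ge0 y; have hz := height_ge0 z.
case: asboolP => xy; case: asboolP => xz; case: asboolP => zy.
- exact: walk_dist_triangle.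
- by case: zy; apply: joined_trans xy; apply: joined_sym.
- by case: xz; apply: joined_trans xy _; apply: joined_sym.
- have rxy := joined_sym (base_point_joined y).
  rewrite -(base_point_eq xy) in rxy.
  have := walk_dist_triangle (base_point_joined x) rxy.
  by rewrite (walk_distC (base_point x)) {2}(base_point_eq xy) -!/(height _); lra.
- by case: xy; apply: joined_trans zy.
- by have := height_le xz; lra.
- by have := height_le (joined_sym zy); rewrite (walk_distC y z); lra.
- lra.
Qed.

End Walks.

(** * Extending a weight to a pseudosemimetric *)

Theorem corollary4p4 (R : realType) (T : Type) (G : graph T) (w : set T -> R)
    (phi : R -> R) :
  is_weight G w ->
  Rplus_homeo phi ->
  Phi_pseudosemimetrizable (fun x y => Rplus_inv phi (phi x + phi y)) G w <->
  (forall C : graph T, is_cycle C -> subgraph C G ->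
   forall e : set T, edges C e ->
     w e <= Rplus_inv phi (\sum_(f \in edges C `\ e) phi (w f))).
Proof.
move=> w_ge0 phi_homeo; rewrite cycle_ineq_indexed//.
have w0 e : edges G e -> 0 <= w e by move=> /w_ge0/RplusP.
split=> [[d [[[d_ge0 d0 dC] d_tri] wd]] n x n3 x_inj xG k|ineq].
  have xV i : verts G (x i) by case: (edge_verts (xG i)).
  rewrite wd//; under eq_bigr do rewrite wd//.
  apply: (@metric_cycle_ineq _ _ (verts G) (fun u v => phi (d u v))) => //.
  - by move=> y Gy; rewrite d0// homeo0.
  - by move=> y z Gy Gz; rewrite dC.
  - move=> y z t Gy Gz Gt.
    have dge0 a b : verts G a -> verts G b -> 0 <= d a b.
      by move=> Ga Gb; apply/RplusP/d_ge0.
    have := d_tri _ _ _ Gy Gz Gt.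
    by rewrite le_homeo_inv ?addr_ge0 ?homeo_ge0 ?dge0// (dC z t).
have [x0 _] := verts_nonempty G.
(* [{classic T}] supplies the decidable equality used to cut out detours,
   and the choice of base points. *)
pose e : rel {classic T} := fun u v => `[< edges G [set u; v] >].
pose c (u v : {classic T}) := phi (w [set u; v]).
have eP u v : e u v -> edges G [set u; v] by move/asboolP.
have eC : symmetric e by move=> u v; rewrite /e setUC.
have cC u v : c u v = c v u by rewrite /c setUC.
have c_ge0 u v : e u v -> 0 <= c u v by move=> /eP/w0/(homeo_ge0 phi_homeo).
have e_irr : irreflexive e.
  move=> u; apply/asboolP => /edgesP[a [b [_ _ ab E]]]; apply: ab.
  by case: (set2_eqP E) => -[<- <-].
have cycle_ineq n (x : 'I_n -> {classic T}) : (3 <= n)%N -> injective x ->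
    (forall i, e (x i) (x (ordS i))) -> forall k,
    c (x k) (x (ordS k)) <= \sum_(i < n | i != k) c (x i) (x (ordS i)).
  by move=> n3 x_inj xe; apply: ineq => // i; apply: eP.
pose D := glued_dist e c x0.
have D_ge0 x y : 0 <= D x y by apply: glued_dist_ge0.
have D0 x : D x x = 0 by apply: glued_dist0.
have DC x y : D x y = D y x by apply: glued_distC.
have D_tri x y z : D x y <= D x z + D z y by apply: glued_dist_triangle.
exists (fun x y => Rplus_inv phi (D x y)); split; [split; [split|]|].
- by move=> x y _ _; apply/RplusP/homeo_inv_ge0.
- by move=> x _; rewrite D0 -[X in Rplus_inv _ X](homeo0 phi_homeo) homeoK.
- by move=> x y _ _; rewrite DC.
- move=> x y z _ _ _; rewrite !homeo_invK//.
  rewrite le_homeo_inv ?homeo_inv_ge0 ?addr_ge0// homeo_invK//.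
  by rewrite (DC y z).
- move=> u v Guv; rewrite /D glued_dist_edge//; last exact/asboolP.
  by rewrite homeoK ?w0.
Qed.
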